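(* Let $G=(V,E)$ be a finite connected graph with Euler characteristic $\chi(G)=|E|-|V|+1$. Then the lamplighter graph metric on $G$, i.e. the metric space $\mathsf{La}(G)$ with its graph distance, bi-Lipschitzly embeds into $L_1$ with distortion $O(\log(\chi(G)))$.
   Context: The number $\chi(G)=|E|-|V|+1$ is called the Euler number, or Euler characteristic, of the graph $G=(V,E)$. The lamplighter graph $\mathsf{La}(G)$ of $G=(V,E)$ has as vertices all pairs $(A,x)$ with $A$ a finite subset of $V$ and $x\in V$; two vertices $(A,x)$ and $(B,y)$ are joined by an edge if and only if either $A=B$ and $xy\in E$, or $x=y$ and $A\triangle B=\{x\}$, where $\triangle$ denotes symmetric difference. It is equipped with the shortest path distance. $L_1$ denotes the Banach space $L_1(\mu)$ of integrable functions on a measure space, with norm $\|\cdot\|_1$. A metric space $(M,d_M)$ bi-Lipschitzly embeds into $L_1$ with distortion at most $D\ge 1$ if there are $s>0$ and $f\colon M\to L_1$ with $s\,d_M(x,y)\le\|f(x)-f(y)\|_1\le D s\,d_M(x,y)$ for all $x,y\in M$. The constant implied in $O(\cdot)$ is universal, i.e. does not depend on $G$.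
   Formalization: The bound O(log χ(G)) is read as C·log(max(2, χ(G))) with C universal: for trees (χ = 0) log χ is undefined, and for graphs with one cycle (χ = 1) it is 0 while distortion is at least 1; there the claim is a universal bound on the distortion. *)

(* Defs.v *)
(* MathComp / MathComp-Analysis *)
From HB Require Import structures.
From mathcomp Require Import all_boot all_order all_algebra.
From mathcomp Require Import all_classical all_reals all_analysis.
Set Implicit Arguments.
Unset Strict Implicit.
Unset Printing Implicit Defensive.
Import Order.TTheory GRing.Theory Num.Theory.

Local Open Scope ring_scope.

Record sgraph := SGraph {
  vertex :> finType;
  adj : rel vertex;
  adj_sym : symmetric adj;
  adj_irrefl : irreflexive adj }.

Definition edges (G : sgraph) : {set {set G}} :=
  [set [set p.1; p.2] | p : G * G & adj p.1 p.2].

Definition connected_graph (G : sgraph) : Prop :=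
  forall x y : G, connect (@adj G) x y.

(* This is 0 for trees and 1 for unicyclic graphs, where log(euler_char G) is
   not a meaningful multiplicative bound; bounds of order log(euler_char G) are
   therefore expressed with Num.max 2 (euler_char G), i.e. as a universal
   constant in these two cases. *)
Definition euler_char (G : sgraph) : int := #|edges G|%:Z - #|G|%:Z + 1.

Definition has_walk (G : sgraph) (x y : G) (n : nat) : bool :=
  [exists p : n.-tuple G, path (@adj G) x p && (last x p == y)].

(* Shortest walks have length < #|G|, so the bounded search is exact whenever
   x and y are connected (see [gdist_walk] and [gdist_min]); otherwise it
   returns the junk value #|G|. *)
Definition gdist (G : sgraph) (x y : G) : nat :=
  find (has_walk x y) (iota 0 #|G|).

Lemma has_walkP (G : sgraph) (x y : G) (n : nat) :
  reflect (exists p : seq G,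
             [/\ path (@adj G) x p, last x p = y & size p = n])
          (has_walk x y n).
Proof.
apply: (iffP existsP) => [[p /andP[xp /eqP py]]|[p [xp py /eqP sp]]].
  by exists p; rewrite size_tuple.
by exists (Tuple sp); rewrite /= xp py eqxx.
Qed.

Lemma gdist_min (G : sgraph) (x : G) (p : seq G) :
  path (@adj G) x p -> (gdist x (last x p) <= size p)%N.
Proof.
move=> xp; rewrite leqNgt; apply/negP => lt.
have := before_find 0%N lt.
have lt' : (size p < #|G|)%N.
  by apply: (leq_trans lt); rewrite -[X in (_ <= X)%N](size_iota 0) find_size.
rewrite nth_iota// add0n => /negbT/negP; apply; apply/has_walkP.
by exists p.
Qed.

Lemma gdist_walk (G : sgraph) (x y : G) :
  connect (@adj G) x y -> has_walk x y (gdist x y).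
Proof.
move=> /connectP[p0 /shortenP[p xp up _] ->].
have hp : has (has_walk x (last x p)) (iota 0 #|G|).
  apply/hasP; exists (size p); last by apply/has_walkP; exists p.
  by rewrite mem_iota /= add0n; have := max_card (mem (x :: p));
     rewrite (card_uniqP up).
have := nth_find 0%N hp; rewrite nth_iota//.
by rewrite -[X in (_ < X)%N](size_iota 0) -has_find.
Qed.

Section Lamplighter.
Variable G : sgraph.

Definition symdiff (A B : {set G}) : {set G} := (A :\: B) :|: (B :\: A).

(* G is finite, so {set G} is the type of all its finite subsets. *)
Definition lamp_adj : rel ({set G} * G) := fun u v =>
  (u.1 == v.1) && adj u.2 v.2 || (u.2 == v.2) && (symdiff u.1 v.1 == [set u.2]).

Lemma lamp_adj_sym : symmetric lamp_adj.
Proof.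
move=> [A x] [B y]; rewrite /lamp_adj/= [A == B]eq_sym adj_sym; congr (_ || _).
by rewrite [x == y]eq_sym; case: eqP => //= ->; rewrite /symdiff finset.setUC.
Qed.

Lemma lamp_adj_irrefl : irreflexive lamp_adj.
Proof.
move=> [A x]; rewrite /lamp_adj/= adj_irrefl andbF eqxx/=.
rewrite /symdiff finset.setDv finset.setU0.
by apply/negbTE; rewrite eq_sym; apply/set0Pn; exists x; rewrite inE.
Qed.

Definition lamplighter : sgraph := SGraph lamp_adj_sym lamp_adj_irrefl.

Lemma lamplighter_connected :
  connected_graph G -> connected_graph lamplighter.
Proof.
move=> cG [A x] [B y].
have W (C : {set G}) (u v : G) : connect lamp_adj (C, u) (C, v).
  have /connectP[p] := cG u v; elim: p u => [|w p IH] u /=.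
    by move=> _ ->; exact: connect0.
  move=> /andP[uw wp] ev; apply: connect_trans (IH w wp ev).
  by apply: connect1; rewrite /lamp_adj/= eqxx uw.
have S (C : {set G}) (z u : G) :
    connect lamp_adj (C, u) (symdiff C [set z], u).
  apply: connect_trans (W C u z) _; apply: connect_trans (W _ z u).
  apply: connect1; rewrite /lamp_adj/= eqxx/=; apply/orP; right.
  by apply/eqP/setP => w; rewrite !inE; case: (w \in C); case: (w == z).
move: {2}#|_| (leqnn #|symdiff A B|) => n.
elim: n A => [|n IH] A.
  rewrite leqn0 cards_eq0 => /eqP/setP AB; suff -> : A = B by exact: W.
  apply/setP => w; move: (AB w); rewrite !inE.
  by case: (w \in A); case: (w \in B).
have [/eqP AB _|[z zAB] le] := set_0Vmem (symdiff A B).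
  by apply: IH; rewrite (eqP AB) cards0.
apply: connect_trans (S A z x) (IH _ _).
suff -> : symdiff (symdiff A [set z]) B = symdiff A B :\ z.
  by rewrite (cardsD1 z) zAB in le.
apply/setP => w; move: zAB; rewrite !inE; have [->|] := eqVneq w z.
  by case: (z \in A); case: (z \in B).
by case: (w \in A); case: (w \in B).
Qed.

End Lamplighter.

(* The points of L_1(mu) are given by integrable representatives; the
   inequalities do not depend on their choice. *)
Definition embeds_into_L1 (R : realType) (M : Type) (dM : M -> M -> R) (D : R)
    : Prop :=
  1 <= D /\
  exists (d : measure_display) (T : measurableType d)
         (mu : {measure set T -> \bar R}) (s : R)
         (f : M -> LfunType mu (lexx (1%E : \bar R))),
    0 < s /\
    forall x y : M,
      ((s * dM x y)%:E <= 'N[mu]_1[EFin \o (f x - f y)%R])%E /\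
      ('N[mu]_1[EFin \o (f x - f y)%R] <= (D * s * dM x y)%:E)%E.

(* Main.v *)
Require Import Defs.
From mathcomp Require Import all_boot all_order all_algebra.
From mathcomp Require Import all_classical all_reals all_analysis.
From mathcomp Require Import fingroup perm zify ring lra.
Import Order.TTheory GRing.Theory Num.Theory.

(**
  A labelling [c : G -> L] yields cuts of the lamplighter graph: for a label [l]
  with fibre [F], send [(A, x)] to [A :\: F] if [x] lies in [F] and to
  [A :&: F] otherwise, remembering which case occurred.  This distinguishes
  [(A, x)] from [(B, y)] exactly when [F] cuts [Z = {x, y} u (A symdiff B)],
  so an indicator embedding built from a random labelling has distance at least
  the expected number of labels on [Z] minus one, and an edge [xy] of [G] is
  stretched only by the labellings with [c x != c y].  It suffices to find
  random families of labellings such that every [Z] has a closed tour of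
  length [O(sum_i (#|c_i @: Z| - 1))] and such that edges are rarely separated.

  Tours are bounded by removing a point [z] of [Z]: the tour shrinks by at most
  twice the distance from [z] to the rest, and the sum of label counts drops by
  the number of labellings in which [z] is alone with its label.

  The labellings come from a random spanning forest of [G] rooted at a set [K]
  of [O(chi)] vertices.  They are the indicators of the subtrees of the forest,
  together with the random ball carvings of [K] of Fakcharoenphol, Rao and
  Talwar, one for each integer radius, pulled back along the root map.  The set
  [K] contains the endpoints of the [chi] edges outside a breadth-first tree and
  is closed under branching, so that the tree splits at [K] into paths with
  pendant trees; the forest is obtained by removing a uniformly chosen edge of
  each path.  Removing an edge of a path of length [l] costs [O(l log #|K|)] and
  happens with probability [1 / l].
*)

Set Implicit Arguments.
Unset Strict Implicit.
Unset Printing Implicit Defensive.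
Local Open Scope nat_scope.

(** * Distances and tours *)

Section GraphDistance.
Variable G : sgraph.
Hypothesis cG : connected_graph G.
Implicit Types (x y z : G) (Z : {set G}).

Lemma gdistP x y :
  exists p, [/\ path (@adj G) x p, last x p = y & size p = gdist x y].
Proof. exact/has_walkP/gdist_walk/cG. Qed.

Lemma gdistxx x : gdist x x = 0.
Proof. by have := @gdist_min G x [::] isT; rewrite leqn0 => /eqP. Qed.

Lemma gdist_adj x y : adj x y -> gdist x y <= 1.
Proof. by move=> xy; apply: (@gdist_min G x [:: y]); rewrite /= xy. Qed.

Lemma gdist_triangle x y z : gdist x z <= gdist x y + gdist y z.
Proof.
have [p [xp py <-]] := gdistP x y; have [q [yq qz <-]] := gdistP y z.
rewrite -size_cat -qz -py -last_cat; apply: gdist_min.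
by rewrite cat_path xp py.
Qed.

Lemma gdist_sym x y : gdist x y = gdist y x.
Proof.
suff le (u v : G) : gdist u v <= gdist v u by apply/eqP; rewrite eqn_leq !le.
have [p [vp pu <-]] := gdistP v u.
have vE : last u (rev (belast v p)) = v.
  by case: p vp pu => [|w p] //= _ _; rewrite rev_cons last_rcons.
rewrite -[X in gdist u X]vE -(size_belast v p) -size_rev; apply: gdist_min.
by rewrite -pu rev_path (eq_path (e' := @adj G)) // => a b; rewrite adj_sym.
Qed.

Definition tour Z (L : nat) : Prop := exists x p,
  [/\ path (@adj G) x p, last x p = x, {subset Z <= x :: p} & size p <= L].

Lemma tour1 x : tour [set x] 0.
Proof. by exists x, [::]; split=> // y; rewrite !inE. Qed.

Lemma tour_leq Z L L' : L <= L' -> tour Z L -> tour Z L'.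
Proof.
by move=> LL' [x [p [? ? ? s]]]; exists x, p; split=> //; apply: leq_trans LL'.
Qed.

(** The closed walk is interrupted at a visit to [q] by a shortest walk to [z] and back. *)
Lemma tour_detour Z L q z :
  q \in Z -> tour Z L -> tour (z |: Z) (L + 2 * gdist q z).
Proof.
move=> qZ [x [p [xp px Zp sp]]].
have /splitPl E := Zp _ qZ; case: E xp px Zp sp => p1 p2 p1q.
rewrite cat_path last_cat p1q => /andP[xp1 qp2] p2x Zp sp.
have [w [qw wz sw]] := gdistP q z; have [w' [zw' w'q sw']] := gdistP z q.
exists x, (p1 ++ w ++ w' ++ p2); split.
- by rewrite !cat_path xp1 p1q qw wz zw' w'q.
- by rewrite !last_cat p1q wz w'q.
- move=> y; rewrite !inE => /orP[/eqP->|/Zp].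
    have := mem_last q w; rewrite wz inE => /orP[/eqP->|zw].
      by have := mem_last x p1; rewrite p1q inE mem_cat;
         case/orP=> -> //; rewrite orbT.
    by rewrite !mem_cat zw !orbT.
  by rewrite inE !mem_cat => /or3P[]->; rewrite ?orbT.
move: sp; rewrite !size_cat sw sw' (gdist_sym z q); lia.
Qed.

End GraphDistance.

(** * Walks of the lamplighter *)

Section LamplighterDistance.
Variable G : sgraph.
Hypothesis cG : connected_graph G.
Implicit Types (x y : G) (A B Z : {set G}).

(** The lamplighter follows [p] and toggles each lamp of [symdiff A B] on the first visit to it; the
    induction on [p] updates [A] after a toggle. *)
Lemma lamplighter_gdist_walk x p A B :
  path (@adj G) x p -> {subset symdiff A B <= x :: p} ->
  @gdist (lamplighter G) (A, x) (B, last x p) <= size p + #|symdiff A B|.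
Proof.
have cL := lamplighter_connected cG.
have switch (x' : G) A' B' : symdiff A' B' = [set x'] ->
    @gdist (lamplighter G) (A', x') (B', x') <= 1.
  by move=> e; apply: gdist_adj; rewrite /= /lamp_adj/= e !eqxx orbT.
have same A' B' : symdiff A' B' = finset.set0 -> A' = B'.
  move=> /finset.setP e; apply/finset.setP => w; move: (e w); rewrite !inE.
  by case: (w \in A'); case: (w \in B').
elim: p x A => [|y p IH] x A /=.
  move=> _ sub; have [AB0|[z zAB]] := set_0Vmem (symdiff A B).
    by rewrite (same _ _ AB0) (gdistxx (G := lamplighter G)).
  have AB1 : symdiff A B = [set x].
    apply/finset.setP => w; rewrite inE; apply/idP/eqP => [/sub|->].
      by rewrite inE => /eqP.
    by move: (zAB) => /sub; rewrite inE => /eqP <-.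
  by rewrite AB1 cards1; apply: switch.
move=> /andP[xy yp] sub.
have step A' : {subset symdiff A' B <= y :: p} ->
    @gdist (lamplighter G) (A', x) (B, last y p)
      <= (size p).+1 + #|symdiff A' B|.
  move=> /(IH _ _ yp) le.
  apply: leq_trans (gdist_triangle (G := lamplighter G) cL _ (A', y) _) _.
  rewrite addSn -add1n; apply: leq_add => //.
  by apply: gdist_adj; rewrite /= /lamp_adj/= eqxx xy.
have [xAB|xAB] := boolP (x \in symdiff A B); last first.
  apply: step => z zAB; have := sub z zAB; rewrite inE => /orP[/eqP zx|//].
  by rewrite -zx zAB in xAB.
pose A' := symdiff A [set x].
have A'B : symdiff A' B = symdiff A B :\ x.
  apply/finset.setP => w; move: xAB; rewrite !inE; have [->|] := eqVneq w x.
    by case: (x \in A); case: (x \in B).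
  by case: (w \in A); case: (w \in B).
rewrite (cardsD1 x) xAB add1n addnS -addSn -A'B.
apply: leq_trans (gdist_triangle (G := lamplighter G) cL _ (A', x) _) _.
rewrite addSn -add1n; apply: leq_add.
  apply: switch; apply/finset.setP => w; rewrite !inE.
  by case: (w \in A); case: (w == x).
apply: step => z; rewrite A'B !inE => /andP[zx zAB].
have := sub z; rewrite !inE => /(_ zAB) /orP[/eqP zx'|//].
by rewrite zx' eqxx in zx.
Qed.

(** Rotated to start at [x], the tour is run once to set all lamps and then continued to [y], which
    costs at most a second round. *)
Lemma lamplighter_gdist_tour Z L x y A B :
  tour Z L -> x \in Z -> y \in Z -> symdiff A B \subset Z ->
  @gdist (lamplighter G) (A, x) (B, y) <= 2 * L + #|symdiff A B|.
Proof.
move=> [x0 [p [xp px Zp sp]]] xZ yZ /fintype.subsetP ABZ.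
have /splitPl E := Zp _ xZ; case: E xp px Zp sp => p1 p2 p1x.
rewrite cat_path last_cat p1x => /andP[xp1 xp2] p2x0 Zp sp.
have sub w : w \in Z -> w \in x :: (p2 ++ p1).
  move=> /Zp; rewrite !(inE, mem_cat) => /or3P[/eqP->|->|->]; rewrite ?orbT//.
  have := mem_last x p2; rewrite p2x0 inE => /orP[]->; rewrite ?orbT//.
have xpp : path (@adj G) x (p2 ++ p1) by rewrite cat_path xp2 p2x0 xp1.
have lpp : last x (p2 ++ p1) = x by rewrite last_cat p2x0.
have spp : size (p2 ++ p1) <= L by move: sp; rewrite !size_cat addnC.
move: (p2 ++ p1) xpp lpp spp sub => q xq qx sq sub.
move=> {p1 p2 p1x xp1 xp2 p2x0 Zp sp}.
have /splitPl E := sub _ yZ; case: E xq qx sq sub => q1 q2 q1y.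
rewrite cat_path last_cat q1y => /andP[xq1 yq2] q2x sq sub.
have -> : y = last x ((q1 ++ q2) ++ q1) by rewrite !last_cat q1y q2x.
apply: leq_trans (lamplighter_gdist_walk (B := B) _ _) _.
- by rewrite !cat_path last_cat xq1 q1y yq2 q2x.
- move=> w /ABZ /sub; rewrite !(inE, mem_cat).
  by case/or3P=> ->; rewrite ?orbT.
rewrite leq_add2r; move: sq; rewrite !size_cat.
by move: (size q1) (size q2) => a b; clear; lia.
Qed.

End LamplighterDistance.

(** * Labellings of rooted forests *)

Section TourOfLabellings.
Variable G : sgraph.
Hypothesis cG : connected_graph G.

Lemma card_imset_setD1 (T L : finType) (f : T -> L) (Z : {set T}) z :
  z \in Z -> #|f @: Z| = (f z \notin f @: (Z :\ z)) + #|f @: (Z :\ z)|.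
Proof. by move=> zZ; rewrite -{1}(finset.setD1K zZ) imsetU1 cardsU1. Qed.

(** Induction on [#|Z|], restoring [z] by [tour_detour]. The factor 4 is the 2 of the hypothesis
    times 2 for going and returning. *)
Lemma tour_labels (I L : finType) (c : I -> G -> L) :
  (forall Z : {set G}, 1 < #|Z| -> exists z q,
     [/\ z \in Z, q \in Z :\ z
       & gdist z q <= 2 * \sum_i (c i z \notin c i @: (Z :\ z))]) ->
  forall Z : {set G}, Z != finset.set0 ->
    tour Z (4 * \sum_i (#|c i @: Z|).-1).
Proof.
move=> isolated Z; have [m] := ubnP #|Z|; elim: m Z => // m IH Z Zm Z0.
have [Z1|Z1] := leqP #|Z| 1.
  have /cards1P[x ->] : #|Z| == 1 by rewrite eqn_leq Z1 card_gt0.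
  exact: tour_leq (tour1 _).
have [z [q [zZ qZ zq]]] := isolated Z Z1.
have Zz : #|Z| = #|Z :\ z|.+1 by rewrite (cardsD1 z) zZ.
have Zz0 : Z :\ z != finset.set0 by apply/set0Pn; exists q.
have := tour_detour cG z qZ (IH (Z :\ z) _ Zz0); rewrite -Zz => /(_ Zm).
rewrite finset.setD1K //; apply: tour_leq.
have -> : \sum_i (#|c i @: Z|).-1 = \sum_i (c i z \notin c i @: (Z :\ z))
                                    + \sum_i (#|c i @: (Z :\ z)|).-1.
  rewrite -big_split; apply: eq_bigr => i _.
  (* The truncated predecessors add up only because this image is nonempty. *)
  have : 0 < #|c i @: (Z :\ z)|.
    by rewrite card_gt0; apply/set0Pn; exists (c i q); apply: imset_f.
  by rewrite (card_imset_setD1 _ zZ); case: #|c i @: (Z :\ z)| => // k _;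
     rewrite addnS.
by rewrite (gdist_sym cG q z); move: zq; clear; lia.
Qed.

End TourOfLabellings.

Section RootedForest.
Variable G : sgraph.
Hypothesis cG : connected_graph G.
Implicit Types (u v z q : G) (Z : {set G}).

Record rooted_forest (K : {set G}) (par : G -> G) (dep : G -> nat) : Prop := {
  forest_root : forall v, (dep v == 0) = (v \in K);
  forest_dep : forall v, v \notin K -> dep v = (dep (par v)).+1;
  forest_adj : forall v, v \notin K -> adj v (par v) }.

Variables (K : {set G}) (par : G -> G) (dep : G -> nat).
Hypothesis F : rooted_forest K par dep.

Definition root_of v := iter (dep v) par v.
(** In a rooted forest at most [dep u] steps are taken, so [par], which is arbitrary on [K], is
    never applied to a root. *)
Definition ancestor v u :=
  (dep v <= dep u) && (iter (dep u - dep v) par u == v).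

Lemma dep_gt0 v : (0 < dep v) = (v \notin K).
Proof. by rewrite lt0n (forest_root F). Qed.

Lemma dep_iter_par i u : i <= dep u -> dep (iter i par u) = dep u - i.
Proof.
elim: i => [|i IH] iu; first by rewrite subn0.
have iK : iter i par u \notin K by rewrite -dep_gt0 IH ?subn_gt0 // ltnW.
by move: (forest_dep F iK); rewrite IH 1?ltnW //= subnS => ->.
Qed.

Lemma gdist_iter_par i u : i <= dep u -> gdist u (iter i par u) <= i.
Proof.
elim: i => [|i IH] iu; first by rewrite gdistxx.
apply: leq_trans (gdist_triangle cG _ (iter i par u) _) _.
have step : adj (iter i par u) (iter i.+1 par u).
  by apply: (forest_adj F); rewrite -dep_gt0 dep_iter_par ?subn_gt0 // ltnW.
by rewrite -[leqRHS]addn1; apply: leq_add (IH (ltnW iu)) (gdist_adj step).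
Qed.

Lemma root_of_K v : root_of v \in K.
Proof. by rewrite -(forest_root F) dep_iter_par // subnn. Qed.

Lemma root_of_par v : v \notin K -> root_of (par v) = root_of v.
Proof. by move=> vK; rewrite /root_of (forest_dep F vK) -iterSr. Qed.

Lemma ancestor_iter i u : i <= dep u -> ancestor (iter i par u) u.
Proof.
by move=> iu; rewrite /ancestor dep_iter_par // subKn // leq_subr eqxx.
Qed.

Lemma ancestor_par v u : v \notin K ->
  ancestor u v = (u == v) || ancestor u (par v).
Proof.
move=> vK; rewrite /ancestor; have [->|uv] := eqVneq u v.
  by rewrite leqnn subnn /= eqxx.
rewrite (forest_dep F vK); have [le|gt] := leqP (dep u) (dep (par v)).
  by rewrite leqW // subSn // iterSr.
rewrite leq_eqVlt [_ < _]ltnNge gt orbF /=; case: eqP => //= ->.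
by rewrite subnn /= eq_sym (negbTE uv).
Qed.

Lemma ancestor_refl u : ancestor u u.
Proof. by rewrite /ancestor leqnn subnn /= eqxx. Qed.

Lemma ancestor_leq v u : ancestor v u -> dep v <= dep u.
Proof. by case/andP. Qed.

Lemma ancestorE v u : ancestor v u -> v = iter (dep u - dep v) par u.
Proof. by case/andP=> _ /eqP. Qed.

Lemma ancestor_eq v u : ancestor v u -> dep v = dep u -> v = u.
Proof. by move=> vu e; rewrite (ancestorE vu) e subnn. Qed.

Lemma ancestor_chain v w u :
  ancestor v u -> ancestor w u -> dep v <= dep w -> ancestor v w.
Proof.
move=> vu wu vw; rewrite /ancestor vw [X in iter _ _ X](ancestorE wu) -iterD.
by rewrite addnC addnBA // subnK ?ancestor_leq // -(ancestorE vu) eqxx.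
Qed.

Lemma ancestor_trans v w u : ancestor v w -> ancestor w u -> ancestor v u.
Proof.
move=> vw wu; have le := leq_trans (ancestor_leq vw) (ancestor_leq wu).
rewrite /ancestor le eq_sym [X in X == _](ancestorE vw).
rewrite [X in iter (dep w - _) _ X](ancestorE wu) -iterD.
by rewrite addnC addnBA ?subnK ?ancestor_leq // eqxx.
Qed.

Lemma ancestor_child v u : ancestor v u -> v != u ->
  exists w, [/\ w \notin K, par w = v & ancestor w u].
Proof.
move=> vu neq; have lt : dep v < dep u.
  rewrite ltn_neqAle ancestor_leq // andbT.
  by apply: contra neq => /eqP/(ancestor_eq vu)->.
exists (iter (dep u - (dep v).+1) par u); split.
- by rewrite -dep_gt0 dep_iter_par ?leq_subr // subKn.
- by rewrite -iterS -subSn // -(ancestorE vu).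
- exact/ancestor_iter/leq_subr.
Qed.

(** Passing from [par u] to [u] adds only [u] itself. The count bounds how many subtrees can
    separate the ends of an edge outside the forest. *)
Lemma card_ancestor_notin_K u :
  \sum_(v | v \notin K) ancestor v u = dep u.
Proof.
elim/(well_founded_induction (Wf_nat.well_founded_ltof _ dep)): u => u IH.
have [uK|uK] := boolP (u \in K).
  rewrite big1 => [|v vK].
    by apply/esym/eqP; rewrite (forest_root F).
  apply/eqP; rewrite eqb0; apply: contra vK => /andP[].
  move: uK; rewrite -!(forest_root F) => /eqP->; rewrite leqn0 => ->.
  by [].
rewrite (forest_dep F uK) -[in RHS]IH; last first.
  by rewrite /Wf_nat.ltof (forest_dep F uK).
rewrite (bigD1 u) //= ancestor_par // eqxx /= add1n; congr _.+1.
rewrite [RHS](bigD1 u) //=.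
have -> : ancestor u (par u) = false.
  by rewrite /ancestor (forest_dep F uK) ltnn.
rewrite add0n; apply: eq_bigr => v /andP[_ /negbTE vu].
by rewrite ancestor_par // vu.
Qed.

Variables (n : nat) (c : 'I_n -> G -> G).
Hypothesis n_ge : forall u v, gdist u v <= n.
Hypothesis c_near : forall r v, v \in K -> gdist (c r v) v <= r.

(** For [v] in [K] the labelling is constant and separates nothing, so the index may range over all
    of [G]. *)
Definition forest_label (i : G + 'I_n) (u : G) : option G :=
  match i with
  | inl v => if (v \notin K) && ancestor v u then Some v else None
  | inr r => Some (c r (root_of u))
  end.

(* Take [z] of maximal depth.  Either the path from [z] towards its root first
   meets, after [j] steps, a subtree containing another point [q], which is then
   at distance at most [2 * j]; or [z] is alone in its tree, and its root is at
   distance at least [delta] from the other roots, which isolates it in the ball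
   carvings of radius less than [delta / 2]. *)
Lemma forest_label_isolated Z : 1 < #|Z| -> exists z q,
  [/\ z \in Z, q \in Z :\ z & gdist z q <=
      2 * \sum_i (forest_label i z \notin forest_label i @: (Z :\ z))].
Proof.
move=> Z1; have /set0Pn[z0 z0Z] : Z != finset.set0.
  by rewrite -card_gt0 ltnW.
have [z zZ0 zmax] := @arg_maxnP _ z0 (mem Z) dep z0Z.
have {zZ0} zZ : z \in Z := zZ0.
have Zz0 : 0 < #|Z :\ z| by move: Z1; rewrite (cardsD1 z) zZ.
have /set0Pn[q0 q0Z] : Z :\ z != finset.set0 by rewrite -card_gt0.
exists z; rewrite big_sumType /=.
set S1 := \sum_i _; set S2 := \sum_i _.
pose hit i := [exists q in Z :\ z, ancestor (iter i par z) q].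
(* The subtrees at the first [j] vertices on the way up from [z] contain no other point of [Z], and
   they are distinct since their depths differ. *)
have S1ge j : j <= dep z -> (forall i, i < j -> ~~ hit i) -> j <= S1.
  move=> jz nhit.
  have inj : {in mem 'I_j &, injective (fun i : 'I_j => iter i par z)}.
    move=> i i' _ _ /(congr1 dep).
    have l (k : 'I_j) : k <= dep z by apply: leq_trans jz; exact: ltnW.
    rewrite !dep_iter_par // => e; apply/val_inj.
    by move: e (l i) (l i'); rewrite /=; lia.
  have -> : j = #|[set iter (i : 'I_j) par z | i in 'I_j]|.
    by rewrite card_in_imset // card_ord.
  rewrite -sum1_card /S1 big_mkcond; apply: leq_sum => v _.
  case: ifP => // /imsetP[i _ ->].
  rewrite lt0b; have iz : i < dep z by apply: leq_trans jz; exact: ltn_ord.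
  have -> : iter i par z \notin K.
    by rewrite -dep_gt0 dep_iter_par ?subn_gt0 // ltnW.
  rewrite ancestor_iter 1?ltnW //=; apply/imsetP => -[q qZ] /=.
  case: ifP => // iq _; move: (nhit i (ltn_ord i)) => /negP; apply.
  by apply/existsP; exists q; rewrite qZ; case/andP: iq.
have [/existsP[[j jz] /= hj]|/existsPn nhit] :=
    boolP [exists j : 'I_(dep z).+1, hit j].
  have ex : exists j, hit j by exists j.
  case: (ex_minnP ex) => i /existsP[q /andP[qZ iq]] imin.
  exists q; split => //.
  have iz : i <= dep z by apply: leq_trans (imin _ hj) _.
  have iS : i <= S1.
    by apply: S1ge => // k ki; apply/negP => /imin; rewrite leqNgt ki.
  move: iq; rewrite /ancestor dep_iter_par // => /andP[iq /eqP e].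
  (* Since [q] is no deeper than [z], it is also at most [i] steps from the meeting vertex. *)
  have qz : dep q <= dep z by apply: zmax; move: qZ; rewrite inE => /andP[].
  have := gdist_iter_par iz; rewrite -e => d1.
  have := @gdist_iter_par (dep q - (dep z - i)) q (leq_subr _ _).
  rewrite gdist_sym // => d2.
  have := gdist_triangle cG z (iter (dep q - (dep z - i)) par q) q.
  move: d1 d2 iS qz iz; clear; lia.
have nhit' i : i <= dep z -> ~~ hit i.
  by move=> iz; have := nhit (Ordinal (iz : i < (dep z).+1)).
have zS : dep z <= S1 by apply: S1ge => // i /ltnW; exact: nhit'.
have [q qZ0 qmin] := @arg_minnP _ q0 (mem (Z :\ z))
  (fun q => gdist (root_of z) (root_of q)) q0Z.
have {qZ0} qZ : q \in Z :\ z := qZ0.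
exists q; split => //.
set delta := gdist (root_of z) (root_of q) in qmin.
have dS : delta <= 2 * S2.
  have dn : delta <= n by exact: n_ge.
  apply: (@leq_trans (2 * uphalf delta)).
    by rewrite mul2n -leq_uphalf_double.
  rewrite leq_pmul2l //.
  apply: (@leq_trans (\sum_(r < n) (r < uphalf delta))).
    rewrite -(big_mkord xpredT (fun r => (r < uphalf delta : nat))) /=.
    have un : uphalf delta <= n.
      by apply: leq_trans dn; rewrite leq_uphalf_double; lia.
    rewrite (big_cat_nat (n := uphalf delta)) //= big_nat.
    rewrite (eq_bigr (fun=> 1)) => [|r /andP[_ ->]//].
    by rewrite -big_nat sum_nat_const_nat subn0 muln1 leq_addr.
  (* A center shared with [q'] would put the two roots within [2 * r < delta] of each other, against
     the choice of [q]. *)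
  apply: leq_sum => r _; have [rd|//] := ltnP r (uphalf delta).
  rewrite lt0b; apply/imsetP => -[q' q'Z] [e].
  have := qmin q' q'Z; apply/negP; rewrite -ltnNge /=.
  apply: leq_ltn_trans (gdist_triangle cG _ (c r (root_of z)) _) _.
  have := c_near r (root_of_K z); have := c_near r (root_of_K q').
  rewrite -e (gdist_sym cG (root_of z)).
  by move: rd; rewrite gtn_uphalf_double -mul2n; clear; lia.
(* The route through both roots has length at most [dep z + delta + dep q], hence at most
   [2 * dep z + delta]. *)
have qz : dep q <= dep z by apply: zmax; move: qZ; rewrite !inE => /andP[].
have := gdist_iter_par (leqnn (dep z)); rewrite -/(root_of z).
have := gdist_iter_par (leqnn (dep q)); rewrite -/(root_of q).
have := gdist_triangle cG z (root_of z) q.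
have := gdist_triangle cG (root_of z) (root_of q) q.
rewrite -/delta (gdist_sym cG (root_of q)).
move: zS dS qz; clear; lia.
Qed.

Lemma tour_forest_label Z : Z != finset.set0 ->
  tour Z (4 * \sum_i (#|forest_label i @: Z|).-1).
Proof. exact: (tour_labels cG forest_label_isolated). Qed.

(** The ends of a forest edge share their root, and only the subtree of the lower end separates
    them. For any other edge, each non-root ancestor of an end may do so. *)
Lemma forest_label_edge x y :
  \sum_i (forest_label i x != forest_label i y) <=
  if (par x == y) && (x \notin K) || (par y == x) && (y \notin K) then 1
  else dep x + dep y + \sum_r (c r (root_of x) != c r (root_of y)).
Proof.
rewrite big_sumType /=.
have flip u v : par u = v -> u \notin K ->
  \sum_(w : G) ((if (w \notin K) && ancestor w u then Some w else None) !=
    (if (w \notin K) && ancestor w v then Some w else None)) +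
  \sum_(r < n) (Some (c r (root_of u)) != Some (c r (root_of v))) <= 1.
  move=> <- uK; rewrite root_of_par // [X in _ + X]big1 ?addn0; last first.
    by move=> r _; rewrite eqxx.
  rewrite (bigD1 u) //= big1 ?addn0 ?leq_b1 // => w wu.
  by rewrite ancestor_par // (negbTE wu) eqxx.
case: ifP => [/orP[] /andP[/eqP p pK]|_].
- exact: flip.
- under eq_bigr do rewrite eq_sym; under [X in _ + X]eq_bigr do rewrite eq_sym.
  exact: flip.
apply: leq_add; last by apply: leq_sum => r _.
rewrite -!card_ancestor_notin_K -big_split /= [leqRHS]big_mkcond /=.
apply: leq_sum => v _; case: (v \notin K) => //=.
by case: (ancestor v x); case: (ancestor v y); rewrite ?eqxx.
Qed.

End RootedForest.

(** * Spanning trees and branch closure *)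

(** The depth is the first hitting time of [K]; its minimality later bounds the depths in the random
    forest. *)
Lemma rooted_forest_of_par (G : sgraph) (K : {set G}) (par : G -> G) :
  (forall v, v \notin K -> adj v (par v)) ->
  (forall v, exists i, iter i par v \in K) ->
  exists dep, rooted_forest K par dep /\
    forall v i, iter i par v \in K -> dep v <= i.
Proof.
move=> padj reach; exists (fun v => ex_minn (reach v)); split; last first.
  by move=> v i iK; case: ex_minnP => m _; apply.
split=> v; last exact: padj.
  case: ex_minnP => m mK mmin; apply/eqP/idP => [m0|vK].
    by rewrite m0 in mK.
  by apply/eqP; rewrite -leqn0; apply: (mmin 0).
move=> vK; case: ex_minnP => m mK mmin; case: ex_minnP => m' m'K m'min.
apply/eqP; rewrite eqn_leq mmin ?iterSr //.
case: m mK {mmin} => [|m]; first by rewrite /= (negbTE vK).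
by rewrite iterSr ltnS => /m'min.
Qed.

(** The parent is the second vertex of a shortest walk to [rho]. With [p rho = rho], no edge joins
    [rho] to [p rho]. *)
Lemma bfs_tree (G : sgraph) (rho : G) : connected_graph G ->
  exists p : G -> G, rooted_forest [set rho] p (gdist rho) /\ p rho = rho.
Proof.
move=> cG; have ex v : exists u, if v == rho then u = rho else
    adj v u && (gdist rho v == (gdist rho u).+1).
  have [vr|vr] := eqVneq v rho; first by exists rho.
  have [[|u q] /= [vq qr sq]] := gdistP cG v rho.
    by rewrite qr eqxx in vr.
  case/andP: vq => vu uq; exists u; rewrite vu /= eqn_leq.
  have := gdist_min uq.
  rewrite qr (gdist_sym cG rho v) (gdist_sym cG rho u) -sq !ltnS => ->.
  rewrite andbT -ltnS sq.
  apply: leq_trans (gdist_triangle cG v u rho) _.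
  by rewrite -add1n leq_add2r; apply: gdist_adj.
have {}ex := fun v => cid (ex v).
exists (fun v => sval (ex v)); split; last first.
  by case: (ex rho) => u /=; rewrite eqxx.
split=> v.
- rewrite inE; apply/eqP/eqP => [v0|->]; last exact: gdistxx.
  have [[|u q]] := gdistP cG rho v; rewrite v0; case=> //.
- rewrite inE => vr; case: (ex v) => u /=; rewrite (negbTE vr).
  by case/andP=> _ /eqP.
- by rewrite inE => vr; case: (ex v) => u /=; rewrite (negbTE vr) => /andP[].
Qed.

Section BranchClosure.
Variables (G : sgraph) (rho : G) (p : G -> G) (h : G -> nat).
Hypothesis F : rooted_forest [set rho] p h.
Implicit Types (K : {set G}) (u v w : G).
Let anc := ancestor p h.

Definition above K v := [exists k in K, ancestor p h v k].

(** This amounts to closure of [K] under lowest common ancestors. The conditions on [rho] make [w]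
    and [w'] genuine children of [v]. *)
Definition branch_closed K := forall v w w', v \notin K ->
  w != rho -> w' != rho -> p w = v -> p w' = v ->
  above K w -> above K w' -> w = w'.

Lemma above_ancestor K v w : anc v w -> above K w -> above K v.
Proof.
move=> vw /existsP[k /andP[kK wk]]; apply/existsP; exists k.
by rewrite kK /=; apply: (ancestor_trans vw wk).
Qed.

Lemma ancestor_p w : w != rho -> anc (p w) w.
Proof.
move=> wr; have wR : w \notin [set rho] by rewrite inE.
by rewrite /anc (ancestor_par F) // ancestor_refl orbT.
Qed.

Lemma h_p w : w != rho -> h w = (h (p w)).+1.
Proof. by move=> wr; apply: (forest_dep F); rewrite inE. Qed.

(* [m] is the lowest ancestor of [x] having an element of [K] below it. *)
Lemma branch_closed_add K x : rho \in K -> branch_closed K ->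
  exists m, branch_closed (x |: (m |: K)).
Proof.
move=> rK Kc; have ex : exists i, above K (iter i p x).
  exists (h x); apply/existsP; exists rho; rewrite rK /=.
  have := root_of_K F x; rewrite inE /root_of => /eqP->; exact: ancestor_refl.
case: (ex_minnP ex) => i; set m := iter i p x => mK imin.
have ix : i <= h x.
  apply: imin; apply/existsP; exists rho; rewrite rK /=.
  have := root_of_K F x; rewrite inE /root_of => /eqP->; exact: ancestor_refl.
have mx : anc m x by apply: (ancestor_iter F).
have hm : h m = h x - i by apply: (dep_iter_par F).
exists m => v w w'; rewrite !inE !negb_or => /and3P[vx vm vK] wr w'r pw pw'.
have above_or u : above (x |: (m |: K)) u -> above K u \/ anc u x.
  case/existsP=> k; rewrite !inE => /andP[/or3P[/eqP->|/eqP->|kK] uk].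
  - by right.
  - by left; apply: above_ancestor mK.
  - by left; apply/existsP; exists k; rewrite kK.
(* If one child of [v] is above [K] and the other is above [x] but not above [K], then [v] is the
   lowest ancestor of [x] above [K], that is, [m]. *)
have mixed u u' : u != rho -> u' != rho -> p u = v -> p u' = v ->
    above K u -> anc u' x -> ~~ above K u' -> False.
  move=> ur u'r pu pu' uK u'x u'K.
  have hu' : h u' = (h v).+1 by rewrite -pu' h_p.
  have hmu' : h m < h u'.
    rewrite ltnNge; apply: contra u'K => le.
    by apply: above_ancestor mK; apply: (ancestor_chain u'x mx).
  have vx' : anc v x.
    by apply: ancestor_trans u'x; rewrite -pu'; apply: ancestor_p.
  have vK' : above K v.
    by apply: above_ancestor uK; rewrite -pu; apply: ancestor_p.
  have hx := ancestor_leq vx'.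
  have : i <= h x - h v by apply: imin; rewrite -(ancestorE vx').
  move=> iv; have hvm : h m = h v.
    by move: hmu' hx ix iv; rewrite hm hu'; clear; lia.
  move/eqP: vm; apply; rewrite (ancestorE vx') /m; congr (iter _ _ _).
  by move: hvm hx ix; rewrite hm; clear; lia.
move=> /above_or a /above_or a'.
have [wK|wK] := boolP (above K w); have [w'K|w'K] := boolP (above K w').
- exact: (Kc v).
- case: a' => [|/(mixed _ _ wr w'r pw pw' wK)/(_ w'K)//].
  by rewrite (negbTE w'K).
- case: a => [|/(mixed _ _ w'r wr pw' pw w'K)/(_ wK)//].
  by rewrite (negbTE wK).
case: a a' => [|wx]; first by rewrite (negbTE wK).
case=> [|w'x]; first by rewrite (negbTE w'K).
have e : h w = h w' by rewrite (h_p wr) (h_p w'r) pw pw'.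
apply: (ancestor_eq _ e).
by apply: ancestor_chain wx w'x _; rewrite e.
Qed.

(** Starting from [rho], each point of [U] brings at most itself and one branching vertex. *)
Lemma branch_closure (U : {set G}) : exists K,
  [/\ rho \in K, U \subset K, #|K| <= 1 + 2 * #|U| & branch_closed K].
Proof.
rewrite cardE; have sub (K : {set G}) : {subset enum U <= K} -> U \subset K.
  by move=> UK; apply/fintype.subsetP => x xU; apply: UK; rewrite mem_enum.
suff [K [? ? ? ?]] : exists K : {set G}, [/\ rho \in K, {subset enum U <= K},
    #|K| <= 1 + 2 * size (enum U) & branch_closed K].
  by exists K; split=> //; apply: sub.
elim: (enum U) => [|x s [K [rK sK Ks Kc]]].
  exists [set rho]; rewrite cards1 inE eqxx; split=> // v w w' vr wr w'r pw pw'.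
  case/existsP=> k; rewrite inE => /andP[/eqP-> /ancestor_leq].
  have /eqP-> : h rho == 0 by rewrite (forest_root F) inE.
  by rewrite h_p.
have [m Kc'] := branch_closed_add x rK Kc.
exists (x |: (m |: K)); split=> //.
- by rewrite !inE rK !orbT.
- by move=> y; rewrite !inE => /orP[->//|/sK->]; rewrite !orbT.
rewrite !cardsU1 /=.
by move: Ks; case: (x \notin _); case: (m \notin _); clear; lia.
Qed.

End BranchClosure.

(** * The random forest *)

Section NontreeEdges.
Variables (G : sgraph) (rho : G) (p : G -> G) (h : G -> nat).
Hypothesis F : rooted_forest [set rho] p h.

Definition nontree (x y : G) := [&& adj x y, p x != y & p y != x].

(** The edges from [v] to [p v] are distinct because [p] lowers the depth. They number [#|G| - 1],
    so [euler_char G] edges remain, with two ends each. *)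
Lemma card_nontree_ends : exists U : {set G},
  (forall x y, nontree x y -> x \in U) /\ ((#|U|%:Z <= 2 * euler_char G)%R).
Proof.
pose TE := [set [set v; p v] | v in ~: [set rho]].
have TEinj : {in ~: [set rho] &, injective (fun v => [set v; p v])}.
  move=> u v; rewrite !inE => ur vr /finset.setP e.
  have := e u; rewrite !inE eqxx /= => /esym/orP[/eqP//|/eqP up].
  have := e v; rewrite !inE eqxx /= => /orP[/eqP->//|/eqP vp].
  by have := h_p F ur; have := h_p F vr; rewrite -vp -up; clear; lia.
have TEE : TE \subset edges G.
  apply/fintype.subsetP => e /imsetP[v]; rewrite !inE => vr ->.
  apply/imsetP; exists (v, p v) => //; rewrite inE /=.
  by apply: (forest_adj F); rewrite inE.
have cTE : #|TE| = #|G| - 1.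
  by rewrite card_in_imset // cardsCs finset.setCK cards1.
have G0 : 0 < #|G| by apply/card_gt0P; exists rho.
have eE : (euler_char G = #|edges G :\: TE|%:Z)%R.
  have := cardsD (edges G) TE; have := subset_leq_card TEE.
  rewrite (finset.setIidPr TEE) cTE /euler_char; move: G0.
  by move: #|_ :\: _| #|edges G| #|G| => a b c; clear; lia.
exists (finset.cover (edges G :\: TE)); split=> [x y /and3P[xy px py]|].
  apply/finset.bigcupP; exists [set x; y]; last by rewrite !inE eqxx.
  rewrite inE; apply/andP; split; last first.
    by apply/imsetP; exists (x, y); rewrite ?inE.
  apply/imsetP => -[v]; rewrite !inE => vr /finset.setP e.
  have := e x; have := e y; have := e v; rewrite !inE !eqxx /= orbT.
  move=> /orP[] /eqP->.
    move=> /esym; rewrite [y == x]eq_sym => /orP[/eqP yx|/eqP yp].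
      by move: xy; rewrite yx adj_irrefl.
    by rewrite -yp eqxx in px.
  move=> _ /esym /orP[/eqP yx|/eqP yp].
    by move: xy; rewrite yx adj_irrefl.
  by rewrite -yp eqxx in py.
rewrite eE -PoszM lez_nat mulnC.
apply: leq_trans (leq_card_cover _) _.
rewrite -sum_nat_const; apply: leq_sum => e; rewrite inE => /andP[_].
by case/imsetP=> -[x y] _ ->; rewrite cards2; case: (_ != _).
Qed.

End NontreeEdges.

(** Each of the [q] periods hits the residue [j] at most once. *)
Lemma sum_modn_eq_leq (l q j : nat) : 0 < l ->
  \sum_(t < q * l) (t %% l == j) <= q.
Proof.
move=> l0; elim: q => [|q IH]; first by rewrite mul0n big_ord0.
rewrite mulSn addnC big_split_ord /= -[q.+1]addn1 leq_add //.
under eq_bigr do rewrite modnMDl.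
have [jl|lj] := ltnP j l; last first.
  by rewrite big1 // => i _; rewrite modn_small //; case: eqP => // e;
     move: lj; rewrite -e leqNgt ltn_ord.
rewrite (bigD1 (Ordinal jl)) //= big1 ?addn0 ?leq_b1 // => i ij.
rewrite modn_small //; apply/eqP; rewrite eqb0.
by apply: contra ij => /eqP e; apply/eqP/val_inj.
Qed.

Section RandomForest.
Variables (G : sgraph) (rho : G) (p : G -> G) (h : G -> nat).
Hypothesis F : rooted_forest [set rho] p h.
Variable K : {set G}.
Hypothesis rhoK : rho \in K.
Hypothesis Kc : branch_closed rho p h K.
Implicit Types (v w : G) (t : nat).
Let anc := ancestor p h.
Let abv := above p h K.

(* [K] cuts the tree into vertical paths.  For [v] inside such a path or at its
   lower end, [top v] and [bottom v] are the depths of the ends of the path;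
   [bottom] is a minimum of depths, written as a dual maximum.  When [t] is
   uniform below [n`!], [t] is uniform modulo the length of each path, and the
   edge from [v] to [p v] is removed when [h v = cut t v]. *)
Definition bottom v :=
  \max_u h u - \max_(k in [set k in K | anc v k]) (\max_u h u - h k).
Definition top v := \max_(k in [set k in K | anc k v && (k != v)]) h k.
Definition cut t v := (top v + t %% (bottom v - top v)).+1.
Definition down v := odflt v [pick w | [&& w != rho, p w == v & abv w]].
(** On a path, vertices above the removed edge climb to the upper end and those below it descend to
    the lower end; pendant trees keep their parents. *)
Definition cut_par t v :=
  if v \in K then v else if abv v && (cut t v <= h v) then down v else p v.

Lemma bottom_leq v k : k \in K -> anc v k -> bottom v <= h k.
Proof.
move=> kK vk; have kv : k \in [set k in K | anc v k] by rewrite inE kK.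
have := @leq_bigmax_cond _ _ (fun k => \max_u h u - h k) _ kv.
have := leq_bigmax (F := h) k; rewrite /bottom.
by clear; move: (\max_u h u) (h k) (\max_(_ in _) _) => a b c; lia.
Qed.

Lemma bottom_attained v :
  abv v -> exists k, [/\ k \in K, anc v k & h k = bottom v].
Proof.
case/existsP=> k0 k0v.
have [|k] := @eq_bigmax_cond _ (mem [set k in K | anc v k])
  (fun k => \max_u h u - h k).
  by apply/card_gt0P; exists k0; rewrite inE.
rewrite inE => /andP[kK vk] e; exists k; split=> //.
by rewrite /bottom [X in _ = _ - X]e subKn // leq_bigmax.
Qed.

Lemma leq_bottom v : abv v -> h v <= bottom v.
Proof. by case/bottom_attained=> k [_ /ancestor_leq ? <-]. Qed.

Lemma bottom_eq v : abv v -> h v = bottom v -> v \in K.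
Proof.
by case/bottom_attained=> k [kK vk <-] /(ancestor_eq vk)->.
Qed.

Lemma abv_K v : v \in K -> abv v.
Proof.
by move=> vK; apply/existsP; exists v; rewrite vK; apply: ancestor_refl.
Qed.

Lemma bottom_K v : v \in K -> bottom v = h v.
Proof.
move=> vK; apply/eqP; rewrite eqn_leq bottom_leq ?leq_bottom ?abv_K //.
exact: ancestor_refl.
Qed.

Lemma top_geq k v : k \in K -> anc k v -> k != v -> h k <= top v.
Proof.
by move=> kK kv neq; apply: (leq_bigmax_cond (F := h)); rewrite !inE kK kv.
Qed.

Lemma top_lt v : v != rho -> top v < h v.
Proof.
move=> vr; have hv : 0 < h v by rewrite (h_p F vr).
rewrite -(prednK hv) ltnS; apply/bigmax_leqP => k.
rewrite !inE => /and3P[_ kv neq].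
rewrite -ltnS prednK // ltn_neqAle (ancestor_leq kv) andbT.
by apply: contra neq => /eqP/(ancestor_eq kv)->.
Qed.

Lemma abv_p w : w != rho -> abv w -> abv (p w).
Proof. by move=> wr; apply: above_ancestor; apply: (ancestor_p F). Qed.

Lemma top_p w : w != rho -> p w \notin K -> top w = top (p w).
Proof.
move=> wr pK; apply: eq_bigl => k; rewrite !inE.
case kK: (k \in K) => //=; have kp : k != p w by apply: contraNneq pK => <-.
have wR : w \notin [set rho] by rewrite inE.
rewrite kp andbT /anc (ancestor_par F) //; case: eqVneq => [->|_] /=.
  by rewrite /ancestor (h_p F wr) ltnn.
by rewrite andbT.
Qed.

(** By branch closure, [w] is the only child of [p w] leading to [K]. Together with [top_p] this
    makes [cut] constant along a path. *)
Lemma bottom_p w : w != rho -> p w \notin K -> abv w -> bottom w = bottom (p w).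
Proof.
move=> wr pK aw; congr (_ - _); apply: eq_bigl => k; rewrite !inE.
case kK: (k \in K) => //=; apply/idP/idP => [|pk].
  by apply: ancestor_trans; apply: (ancestor_p F).
have neq : p w != k by apply: contraNneq pK => ->.
have [w' [w'r pw' w'k]] := ancestor_child F pk neq.
suff -> : w = w' by [].
apply: (Kc pK) => //; first by move: w'r; rewrite inE.
by apply/existsP; exists k; rewrite kK.
Qed.

Lemma cut_p t w : w != rho -> p w \notin K -> abv w -> cut t w = cut t (p w).
Proof. by move=> wr pK aw; rewrite /cut bottom_p // top_p. Qed.

Lemma cut_gt t v : top v < cut t v.
Proof. by rewrite ltnS leq_addr. Qed.

(** Path edges are indexed by the depths of their lower ends, from [(top v).+1] to [bottom v]. *)
Lemma cut_leq t v : v != rho -> abv v -> cut t v <= bottom v.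
Proof.
move=> vr av; have tb : top v < bottom v.
  exact: leq_trans (top_lt vr) (leq_bottom av).
rewrite /cut -[leqRHS](subnKC (ltnW tb)) ltn_add2l ltn_mod subn_gt0 //.
Qed.

Lemma downP v : v \notin K -> abv v ->
  [/\ down v != rho, p (down v) = v & abv (down v)].
Proof.
move=> vK /existsP[k /andP[kK vk]]; rewrite /down; case: pickP => [w|none].
  by case/and3P=> ? /eqP.
have neq : v != k by apply: contraNneq vK => ->.
have [w [wr pw wk]] := ancestor_child F vk neq.
have := none w; move: wr; rewrite inE pw eqxx /= => ->.
by case/existsP; exists k; rewrite kK.
Qed.

Lemma down_p w : w != rho -> abv w -> p w \notin K -> down (p w) = w.
Proof.
move=> wr aw pK; have [dr pd ad] := downP pK (abv_p wr aw).
exact: (Kc pK).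
Qed.

Lemma notin_K_rho v : v \notin K -> v != rho.
Proof. by apply: contraNneq => ->. Qed.

Lemma cut_par_adj t v : v \notin K -> adj v (cut_par t v).
Proof.
move=> vK; rewrite /cut_par (negbTE vK).
have pA w : w != rho -> adj w (p w).
  by move=> wr; apply: (forest_adj F); rewrite inE.
case: ifP => [/andP[av _]|_]; last exact/pA/notin_K_rho.
by have [dr pd _] := downP vK av; rewrite adj_sym -{2}pd; apply: pA.
Qed.

Lemma iter_cut_par_K t v i : v \in K -> iter i (cut_par t) v \in K.
Proof. by move=> vK; elim: i => //= i IH; rewrite /cut_par IH. Qed.

(** A step [down] increases the depth by one and preserves [cut] and [bottom]. The number of steps
    bounds the depth of [v] in the forest. *)
Lemma cut_par_down t v : abv v -> v != rho -> cut t v <= h v ->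
  iter (bottom v - h v) (cut_par t) v \in K.
Proof.
move=> av vr; move e: (bottom v - h v) => k.
elim: k v av vr e => [|k IH] v av vr e.
  move=> _; apply: bottom_eq => //.
  by apply/eqP; rewrite eqn_leq leq_bottom // -subn_eq0 e.
move=> cv; have vK : v \notin K.
  by apply: contraPN e => vK; rewrite bottom_K // subnn.
have [dr pd ad] := downP vK av.
rewrite iterSr /cut_par (negbTE vK) av cv -/(cut_par t).
apply: IH => //; first by rewrite bottom_p ?pd // (h_p F dr) pd subnS e.
by rewrite cut_p ?pd // (h_p F dr) pd; apply: leqW.
Qed.

Lemma cut_par_up t v : abv v -> v \notin K -> h v < cut t v ->
  iter (h v - top v) (cut_par t) v \in K.
Proof.
move=> av vK; move e: (h v - top v) => k.
elim: k v av vK e => [|k IH] v av vK e cv.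
  by have := top_lt (notin_K_rho vK); rewrite -subn_gt0 e.
have vr := notin_K_rho vK.
rewrite iterSr {2}/cut_par (negbTE vK) av /= leqNgt cv /=.
have [pK|pK] := boolP (p v \in K); first exact: iter_cut_par_K.
apply: IH => //; first exact: abv_p.
  rewrite -top_p //; move: e (top_lt vr); rewrite (h_p F vr).
  by clear; lia.
by rewrite -cut_p //; apply: leq_trans cv; rewrite (h_p F vr).
Qed.

Lemma cut_par_reach t v : exists i, iter i (cut_par t) v \in K.
Proof.
move e: (h v) => k; elim: k v e => [|k IH] v e.
  by exists 0; move/eqP: e; rewrite (forest_root F) inE => /eqP->.
have [vK|vK] := boolP (v \in K); first by exists 0.
have vr := notin_K_rho vK.
have [av|av] := boolP (abv v).
  have [cv|cv] := leqP (cut t v) (h v).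
    by eexists; apply: cut_par_down cv.
  by eexists; apply: cut_par_up cv.
have [|i iK] := IH (p v); first by move: e; rewrite (h_p F vr) => -[].
by exists i.+1; rewrite iterSr {2}/cut_par (negbTE vK) (negbTE av).
Qed.

Definition forest_edge (par : G -> G) v w :=
  (par v == w) && (v \notin K) || (par w == v) && (w \notin K).

Lemma forest_edge_cut t v : v != rho -> ~~ (abv v && (h v == cut t v)) ->
  forest_edge (cut_par t) v (p v).
Proof.
move=> vr; rewrite /forest_edge negb_and.
have [av /=|av _] := boolP (abv v); last first.
  have vK : v \notin K by apply: contra av; apply: abv_K.
  by rewrite vK /cut_par (negbTE vK) (negbTE av) eqxx.
rewrite neq_ltn => /orP[lt|gt].
  have vK : v \notin K.
    apply: contraTN lt => vK; rewrite -leqNgt -bottom_K //; exact: cut_leq.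
  by rewrite vK /cut_par (negbTE vK) av leqNgt lt eqxx.
(* Otherwise [p v] is the upper end of the path, and [h v] is the least possible value of the
   cut. *)
have pK : p v \notin K.
  apply: contraTN gt => pK; rewrite -leqNgt (h_p F vr).
  apply: leq_ltn_trans (cut_gt _ _).
  apply: top_geq (ancestor_p F vr) _ => //.
  by apply/eqP => e; have := h_p F vr; rewrite e => /n_Sn.
rewrite pK /cut_par [in X in _ || X](negbTE pK) abv_p // -cut_p //.
by move: gt; rewrite (h_p F vr) ltnS => ->; rewrite down_p // eqxx orbT.
Qed.

(** The length of the path divides the factorial, so the removed edge is equidistributed on the
    path. *)
Lemma sum_cut_leq n v : n > 0 -> v != rho -> abv v -> bottom v <= n ->
  \sum_(t < n`!) (h v == cut t v) * (bottom v - top v) <= n`!.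
Proof.
move=> n0 vr av bn; have tb : top v < bottom v.
  exact: leq_trans (top_lt vr) (leq_bottom av).
set l := bottom v - top v; have l0 : 0 < l by rewrite subn_gt0.
have /dvdnP[q ->] : l %| n`!.
  by apply: dvdn_fact; rewrite l0 /=; apply: leq_trans bn; apply: leq_subr.
rewrite -big_distrl /= leq_mul2r; apply/orP; right.
apply: leq_trans (sum_modn_eq_leq q (h v - (top v).+1) l0).
apply: leq_sum => t _.
rewrite /cut -/l; case: eqP => // e; rewrite lt0b e; apply/eqP.
by clear; lia.
Qed.

End RandomForest.

(** When an edge of a path of length [l] is removed, its ends descend and climb to the two ends of
    the path, so their depths sum to at most [l - 1]: the cost [l] is met with probability at most
    [1 / l]. *)
Lemma random_forest (G : sgraph) (rho : G) : connected_graph G ->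
  exists (K : {set G}) (N : nat) (par : nat -> G -> G) (dep : nat -> G -> nat),
  [/\ (#|K|%:Z <= 1 + 4 * euler_char G)%R, 0 < N,
      forall t, rooted_forest K (par t) (dep t)
    & forall x y, adj x y -> \sum_(t < N)
        ~~ forest_edge K (par t) x y * (dep t x + dep t y).+1 <= N].
Proof.
move=> cG; have [p [F pr]] := bfs_tree rho cG; set h := gdist rho in F.
have [U [UP cU]] := card_nontree_ends F.
have [K [rK UK cK Kc]] := branch_closure F U.
have ex t := cid (rooted_forest_of_par (cut_par_adj F rK t)
  (cut_par_reach F rK Kc t)).
exists K, (#|G|)`!, (cut_par rho p h K), (fun t => sval (ex t)); split.
- by move: cK cU; clear; lia.
- exact: fact_gt0.
- by move=> t; case: (ex t) => d [].
move=> x y xy; have [|] := boolP (nontree p x y).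
  (* Both ends of a nontree edge are roots, so each [t] costs at most 1. *)
  move=> nxy; have xK : x \in K by apply: (fintype.subsetP UK); apply: (UP x y).
  have yK : y \in K.
    apply: (fintype.subsetP UK); apply: (UP y x).
    by move: nxy; rewrite /nontree adj_sym [(_ != _) && (_ != _)]andbC.
  apply: (@leq_trans (\sum_(t < (#|G|)`!) 1)); last first.
    by rewrite sum1_card card_ord.
  apply: leq_sum => t _.
  case: (ex t) => d [Fd _] /=.
  move: xK yK; rewrite -!(forest_root Fd) => /eqP-> /eqP->.
  by rewrite muln1 leq_b1.
wlog px : x y xy / p x = y => [wl|_].
  rewrite /nontree xy /= negb_and !negbK => /orP[/eqP px|/eqP py].
    by apply: wl => //; rewrite /nontree px eqxx andbF.
  under eq_bigr => t _ do rewrite /forest_edge orbC [dep in dep.+1]addnC.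
  apply: wl => //; first by rewrite adj_sym.
  by rewrite /nontree py eqxx andbF.
have xr : x != rho.
  by apply: contraTneq xy => xr; rewrite -px xr pr adj_irrefl.
rewrite -px; have [ax|ax] := boolP (above p h K x); last first.
  by rewrite big1 // => t _; rewrite (forest_edge_cut F Kc) // (negbTE ax).
have bn : bottom p h K x <= #|G|.
  have [k [_ _ <-]] := bottom_attained ax.
  by apply: leq_trans (find_size _ _) _; rewrite size_iota.
have G0 : 0 < #|G| by apply/card_gt0P; exists rho.
apply: leq_trans (sum_cut_leq F G0 xr ax bn); apply: leq_sum => t _.
have [e|ne] := eqVneq (h x) (cut p h K t x); last first.
  by rewrite (forest_edge_cut F Kc) // negb_and ne orbT.
rewrite mul1n; apply: (@leq_trans (sval (ex t) x + sval (ex t) (p x)).+1).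
  by rewrite -[leqRHS]mul1n leq_mul2r leq_b1 orbT.
case: (ex t) => d [Fd dmin] /=.
have dx : d x <= bottom p h K x - h x.
  by apply: dmin; apply: (cut_par_down F Kc) => //; rewrite e.
have dp : d (p x) <= h (p x) - top p h K x.
  have [pK|pK] := boolP (p x \in K).
    by move: pK; rewrite -(forest_root Fd) => /eqP->.
  rewrite (top_p F) //; apply: dmin; apply: (cut_par_up F rK Kc) => //.
    exact: (abv_p F).
  by rewrite -(cut_p F Kc) // -e (h_p F xr).
have := top_lt F K xr; have := leq_bottom ax; have hx := h_p F xr.
by move: dx dp hx; clear; lia.
Qed.

(** * Random ball carving *)

Section RandomOrder.
Variable T : finType.
Implicit Types (S : {set T}) (w : T) (s : {perm T}).

Definition first_in s S w :=
  (w \in S) && [forall w' in S, enum_rank (s w) <= enum_rank (s w')].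

Lemma first_inP s S w :
  reflect
    (w \in S /\ forall w', w' \in S -> enum_rank (s w) <= enum_rank (s w'))
    (first_in s S w).
Proof. by apply: (iffP andP) => -[wS /forall_inP]. Qed.

Lemma first_in_uniq s S w w' : first_in s S w -> first_in s S w' -> w = w'.
Proof.
move=> /first_inP[wS le] /first_inP[w'S le'].
apply: (@perm_inj _ s); apply: enum_rank_inj; apply: val_inj; apply/eqP.
by rewrite /= eqn_leq le // le'.
Qed.

Lemma sum_first_in s S : S != finset.set0 -> \sum_(w in S) first_in s S w = 1.
Proof.
case/set0Pn=> w0 w0S; have [w wS wmin] :=
  @arg_minnP _ w0 (mem S) (fun w => enum_rank (s w)) w0S.
have fw : first_in s S w by apply/first_inP.
rewrite (bigD1 w) //= fw big1 ?addn0 // => w' /andP[_ w'w].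
by apply/eqP; rewrite eqb0; apply: contra w'w => /first_in_uniq/(_ fw)->.
Qed.

(** Composing with a transposition shows that all elements of [S] come first equally often, and
    exactly one does for each [s]. *)
Lemma card_first_in S w :
  w \in S -> (\sum_(s : {perm T}) first_in s S w) * #|S| = #|{perm T}|.
Proof.
move=> wS; have sym w' : w' \in S ->
    \sum_(s : {perm T}) first_in s S w' = \sum_(s : {perm T}) first_in s S w.
  move=> w'S; rewrite (reindex_inj (mulgI (tperm w w'))); apply: eq_bigr => s _.
  have tS v : v \in S -> tperm w w' v \in S by case: tpermP => // ->.
  congr nat_of_bool.
  apply/first_inP/first_inP; rewrite permM ?tpermR => -[_ le].
    by split=> // v vS; have := le _ (tS v vS); rewrite permM tpermK.
  by split=> // v vS; rewrite permM; apply/le/tS.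
rewrite mulnC -sum_nat_const -(eq_bigr _ sym) exchange_big /= -sum1_card.
by apply: eq_bigr => s _; rewrite sum_first_in //; apply/set0Pn; exists w.
Qed.

End RandomOrder.

Section BallCarving.
Variable G : sgraph.
Hypothesis cG : connected_graph G.
Variable K : {set G}.
Implicit Types (x y w : G) (s : {perm G}).

(** For [y] in [K] the default [y] is itself a candidate, so the minimum is genuine. *)
Definition first_center s r y : G :=
  [arg min_(w < y | (w \in K) && (gdist w y <= r)) enum_rank (s w)].

Lemma first_center_near s r y : y \in K -> gdist (first_center s r y) y <= r.
Proof.
move=> yK; rewrite /first_center; case: arg_minnP.
  by rewrite yK gdistxx.
by move=> w /andP[].
Qed.

Lemma first_center_eq s r y w : y \in K ->
  first_in s [set w in K | gdist w y <= r] w -> first_center s r y = w.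
Proof.
move=> yK fw; rewrite /first_center; case: arg_minnP.
  by rewrite yK gdistxx.
move=> w' w'K w'min; apply: first_in_uniq fw; apply/first_inP.
by rewrite inE; split=> // v; rewrite inE => /w'min.
Qed.

(* [w] is the first center whose ball of radius [r] contains [x] or [y]. *)
Lemma first_center_neq s r x y : x \in K -> y \in K ->
  first_center s r x != first_center s r y ->
  exists w, [/\ w \in K, minn (gdist w x) (gdist w y) <= r,
    r < maxn (gdist w x) (gdist w y)
    & first_in s [set w' in K | minn (gdist w' x) (gdist w' y)
                                <= minn (gdist w x) (gdist w y)] w].
Proof.
move=> xK yK neq.
pose P := [pred w | (w \in K) && (minn (gdist w x) (gdist w y) <= r)].
have Px : P x by rewrite /= xK gdistxx min0n.
have [w /andP[wK wr] wmin] := @arg_minnP _ x P (fun w => enum_rank (s w)) Px.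
exists w; split=> //; last first.
  apply/first_inP; rewrite !inE wK leqnn; split=> // w'; rewrite inE.
  by case/andP=> w'K le; apply: wmin; rewrite /= w'K (leq_trans le).
rewrite ltnNge geq_max; apply: contra neq => /andP[wx wy].
by rewrite !(@first_center_eq s r _ w) //; apply/first_inP;
  rewrite inE wK; split=> // w'; rewrite inE => /andP[w'K le];
  apply: wmin; rewrite /= w'K geq_min le ?orbT.
Qed.

(** The center [w] separates only at radii between its distances to [x] and [y], at most [gdist x y]
    of them, and the event on [s] does not depend on the radius. *)
Lemma sum_center_neq n x y : x \in K -> y \in K ->
  \sum_(s : {perm G}) \sum_(r < n) (first_center s r x != first_center s r y) <=
  \sum_(w in K) gdist x y * \sum_(s : {perm G})
    first_in s [set w' in K | minn (gdist w' x) (gdist w' y)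
                              <= minn (gdist w x) (gdist w y)] w.
Proof.
move=> xK yK; pose S w := [set w' in K | minn (gdist w' x) (gdist w' y)
                            <= minn (gdist w x) (gdist w y)].
pose cut w r :=
  minn (gdist w x) (gdist w y) <= r < maxn (gdist w x) (gdist w y).
apply: (@leq_trans (\sum_(s : {perm G}) \sum_(r < n) \sum_(w in K)
    cut w r * first_in s (S w) w)).
  apply: leq_sum => s _; apply: leq_sum => r _.
  have [//|/(first_center_neq xK yK)[w [wK lo hi fw]]] :=
    eqVneq (first_center s r x) _.
  by rewrite (bigD1 w) //= /cut lo hi fw.
rewrite [leqLHS](_ : _ = \sum_(w in K) (\sum_(r < n) cut w r) *
    \sum_(s : {perm G}) first_in s (S w) w); last first.
  under [RHS]eq_bigr do rewrite big_distrlr /=.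
  rewrite exchange_big [RHS]exchange_big; apply: eq_bigr => r _.
  exact: exchange_big.
apply: leq_sum => w _; rewrite leq_mul2r; apply/orP; right.
set lo := minn (gdist w x) (gdist w y); set hi := maxn (gdist w x) (gdist w y).
have -> : \sum_(r < n) cut w r = \sum_(0 <= r < n | lo <= r < hi) 1.
  rewrite big_mkord [RHS]big_mkcond; apply: eq_bigr => r _.
  by rewrite -/(cut w r); case: (cut w r).
have sub : \sum_(0 <= r < n | lo <= r < hi) 1 <= hi - lo.
  rewrite sum1_count -[leqRHS](size_iota lo) -size_filter.
  apply: uniq_leq_size.
    by rewrite filter_uniq // iota_uniq.
  move=> r; rewrite mem_filter mem_iota => /andP[+ _].
  by rewrite /=; clear; lia.
apply: leq_trans sub _; rewrite /lo /hi.
have := gdist_triangle cG w x y; have := gdist_triangle cG w y x.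
by rewrite (gdist_sym cG y x); clear; lia.
Qed.

End BallCarving.

Local Open Scope ring_scope.

(** * Harmonic bound for ball carving *)

Section Harmonic.
Variable R : realType.

Definition harmonic_number (m : nat) : R := \sum_(j < m) (j.+1%:R)^-1.

(** An element maximizing [a] contributes the inverse of [#|K|]. Deleting it only shrinks the other
    sets, hence raises the other terms. *)
Lemma sum_inv_rank_le (T : finType) (K : {set T}) (a : T -> nat) :
  \sum_(w in K) (#|[set w' in K | (a w' <= a w)%N]|%:R)^-1
    <= harmonic_number #|K| :> R.
Proof.
have [m] := ubnP #|K|; elim: m K => // m IH K Km.
have [->|[w0 w0K]] := set_0Vmem K; first by rewrite big_set0 sumr_ge0.
have [w wK0 wmax] := @arg_maxnP _ w0 (mem K) a w0K.
have {wK0} wK : w \in K := wK0.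
have Kw : #|K| = #|K :\ w|.+1 by rewrite (cardsD1 w) wK.
rewrite (big_setD1 w) //= Kw /harmonic_number big_ord_recr /= addrC lerD //.
  apply: le_trans (IH _ _); last by rewrite -ltnS -Kw.
  apply: ler_sum => v /setD1P[vw vK].
  rewrite lef_pV2 ?posrE ?ltr0n ?card_gt0 ?ler_nat; first last.
  - by apply/set0Pn; exists v; rewrite !inE vw vK leqnn.
  - by apply/set0Pn; exists v; rewrite !inE vK leqnn.
  apply: subset_leq_card; apply/fintype.subsetP => u; rewrite !inE.
  by case/andP=> /andP[_ ->] ->.
rewrite -Kw lef_pV2 ?posrE ?ltr0n ?card_gt0 ?ler_nat; first last.
- by apply/set0Pn; exists w.
- by apply/set0Pn; exists w; rewrite !inE wK leqnn.
apply: subset_leq_card; apply/fintype.subsetP => u uK; rewrite !inE uK.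
exact: wmax.
Qed.

Lemma harmonic_number_le m : (0 < m)%N -> harmonic_number m <= 1 + ln m%:R.
Proof.
case: m => // m _; elim: m => [|m IH].
  by rewrite /harmonic_number big_ord1 ln1 addr0 invr1.
rewrite /harmonic_number big_ord_recr /= -/(harmonic_number m.+1).
apply: le_trans (lerD IH (lexx _)) _; rewrite -addrA lerD2l.
have m1 : 0 < m.+1%:R :> R by rewrite ltr0n.
have m2 : 0 < m.+2%:R :> R by rewrite ltr0n.
have v0 : 0 < (m.+2%:R)^-1 :> R by rewrite invr_gt0.
have e : 1 + - (m.+2%:R)^-1 = m.+1%:R / m.+2%:R :> R.
  apply: (mulIf (lt0r_neq0 m2)); rewrite mulfVK ?lt0r_neq0 //.
  by rewrite mulrBl mul1r mulVf ?lt0r_neq0 // -natr1 addrK.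
(* By [e], the new term is at most [ln m.+2 - ln m.+1]. *)
have := @le_ln1Dx R (- (m.+2%:R)^-1).
rewrite e ltrN2 invf_lt1 // ltr1n => /(_ isT).
rewrite lnM ?posrE // lnV ?posrE //.
by move: (ln _) (ln _) (_^-1) => a b c; lra.
Qed.

Lemma sum_center_neq_harmonic (G : sgraph) (K : {set G}) n (x y : G) :
  connected_graph G -> x \in K -> y \in K ->
  (\sum_(s : {perm G}) \sum_(r < n)
    (first_center K s r x != first_center K s r y))%N%:R
    <= #|{perm G}|%:R * (gdist x y)%:R * harmonic_number #|K| :> R.
Proof.
move=> cG xK yK; pose a w := minn (gdist w x) (gdist w y).
apply: le_trans (_ : (\sum_(w in K) gdist x y * \sum_(s : {perm G})
    first_in s [set w' in K | a w' <= a w] w)%N%:R <= _).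
  by rewrite ler_nat; apply: sum_center_neq.
apply: le_trans (_ : \sum_(w in K) #|{perm G}|%:R * (gdist x y)%:R *
   (#|[set w' in K | (a w' <= a w)%N]|%:R)^-1 <= _); last first.
  by rewrite -mulr_sumr ler_wpM2l ?mulr_ge0 ?ler0n // sum_inv_rank_le.
rewrite natr_sum; apply: ler_sum => w wK.
set S := [set _ in _ | _]; have wS : w \in S by rewrite inE wK leqnn.
rewrite -(card_first_in wS) !natrM.
have S0 : #|S|%:R != 0 :> R.
  by rewrite pnatr_eq0 -lt0n card_gt0; apply/set0Pn; exists w.
by rewrite mulrAC mulfK // mulrC.
Qed.

End Harmonic.

Lemma harmonic_number_ge0 (R : realType) m : 0 <= harmonic_number R m.
Proof. exact: sumr_ge0. Qed.

(** Forest edges cost at most 1. For any other edge the roots are within [(dep x + dep y).+1], so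
    subtrees and carvings cost at most [1 + H] times this quantity, whose mean is at most 1. *)
Lemma random_labels (R : realType) (G : sgraph) (rho : G) : connected_graph G ->
  exists (W I L : finType) (c : W -> I -> G -> L) (k : nat),
  [/\ (0 < #|W|)%N, (0 < k)%N, k%:Z <= 1 + 4 * euler_char G,
      forall w Z, Z != finset.set0 -> tour Z (4 * \sum_i (#|c w i @: Z|).-1)
    & forall x y, adj x y -> (\sum_w \sum_i (c w i x != c w i y))%N%:R
        <= #|W|%:R * (2 + harmonic_number R k)].
Proof.
move=> cG; have [K [N [par [dep [cK N0 F FN]]]]] := random_forest rho cG.
pose c (w : 'I_N * {perm G}) :=
  @forest_label _ K (par w.1) (dep w.1) #|G| (fun r => first_center K w.2 r).
exists ('I_N * {perm G})%type, (G + 'I_#|G|)%type, (option G), c, #|K|.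
split=> //.
- rewrite card_prod card_ord muln_gt0 N0 /=.
  by apply/card_gt0P; exists (perm_one G).
- apply/card_gt0P; exists (root_of (par 0%N) (dep 0%N) rho).
  exact: (root_of_K (F 0%N)).
- move=> [t s] Z Z0; apply: (tour_forest_label cG (F t)) Z0.
    by move=> u v; apply: leq_trans (find_size _ _) _; rewrite size_iota.
  by move=> r v vK; apply: first_center_near.
move=> x y xy; set H := harmonic_number R _.
have H0 : 0 <= H by apply: harmonic_number_ge0.
pose P : R := #|{perm G}|%:R; have P0 : 0 <= P by apply: ler0n.
pose e t : nat := (~~ forest_edge K (par t) x y * (dep t x + dep t y).+1)%N.
pose phi t := root_of (par t) (dep t).
have le (t : 'I_N) :
  (\sum_(s : {perm G}) \sum_i (c (t, s) i x != c (t, s) i y))%N%:R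
    <= P * (1 + (1 + H) * (e t)%:R).
  apply: le_trans (_ : (\sum_(s : {perm G}) if forest_edge K (par t) x y then 1
     else dep t x + dep t y + \sum_(r < #|G|)
      (first_center K s r (phi t x) != first_center K s r (phi t y)))%N%:R
      <= _).
    rewrite ler_nat; apply: leq_sum => s _.
    exact: (forest_label_edge (F t) (fun r => first_center K s r)).
  rewrite /e; case: (forest_edge K (par t) x y) => /=.
    by rewrite sum1_card mul0n mulr0 addr0 mulr1.
  rewrite mul1n big_split /= sum_nat_const natrD natrM -/P.
  have := sum_center_neq_harmonic R #|G| cG
    (root_of_K (F t) x) (root_of_K (F t) y).
  rewrite -/P -/H => le; apply: le_trans (lerD (lexx _) le) _.
  have d : (gdist (phi t x) (phi t y) <= (dep t x + dep t y).+1)%N.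
    have := gdist_iter_par cG (F t) (leqnn (dep t x)).
    have := gdist_iter_par cG (F t) (leqnn (dep t y)).
    rewrite -/(root_of _ _ x) -/(root_of _ _ y) -/(phi t _) -/(phi t _).
    have := gdist_adj xy.
    have := gdist_triangle cG (phi t x) x (phi t y).
    have := gdist_triangle cG x y (phi t y).
    rewrite (gdist_sym cG _ x); clear; lia.
  have {}d : (gdist (phi t x) (phi t y))%:R
      <= (dep t x + dep t y).+1%:R :> R by rewrite ler_nat.
  rewrite -mulrA -mulrDr ler_wpM2l // mulrDl mul1r addrA.
  apply: lerD; first by rewrite nat1r ler_nat; do 2!apply: leqW.
  by rewrite mulrC ler_wpM2l.
rewrite -(pair_bigA _ (fun t s => \sum_i (c (t, s) i x != c (t, s) i y))%N) /=.
rewrite natr_sum; apply: le_trans (ler_sum _ (fun (t : 'I_N) _ => le t)) _.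
rewrite -mulr_sumr big_split /= sumr_const card_ord -mulr_sumr -natr_sum.
rewrite card_prod card_ord natrM -/P [N%:R * P]mulrC -[leRHS]mulrA ler_wpM2l //.
have le2 : (\sum_(t < N) e t)%N%:R <= N%:R :> R by rewrite ler_nat; apply: FN.
have : (1 + H) * (\sum_(t < N) e t)%N%:R <= (1 + H) * N%:R.
  by apply: ler_wpM2l => //; lra.
lra.
Qed.

(** * The embedding *)

Section FiniteL1.
Variables (R : realType) (J : finType).

Definition nat_extension (g : J -> R) (n : nat) : R :=
  if insub n is Some i then g (enum_val (i : 'I_#|J|)) else 0.

Lemma Lnorm1_finite_support m (g : nat -> R) :
  (forall n, (m <= n)%N -> g n = 0) ->
  'N[@counting nat R]_1[EFin \o g]%E = (\sum_(n < m) `|g n|)%:E.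
Proof.
move=> g0; rewrite Lnorm1 ge0_integral_count; last by move=> k; apply: abse_ge0.
rewrite (nneseries_split 0 m); last by move=> k _; apply: abse_ge0.
rewrite add0n [X in (_ + X)%E]eseries0; last first.
  by move=> i mi _; rewrite /= g0 // normr0.
by rewrite adde0 big_mkord sumEFin.
Qed.

Lemma Lnorm1_nat_extension (g : J -> R) :
  'N[@counting nat R]_1[EFin \o nat_extension g]%E = (\sum_j `|g j|)%:E.
Proof.
rewrite (@Lnorm1_finite_support #|J|); last first.
  by move=> n Jn; rewrite /nat_extension insubF // ltnNge Jn.
congr _%:E; rewrite (reindex (fun i : 'I_#|J| => enum_val i)) /=; last first.
  by exists enum_rank => i _; rewrite ?enum_valK ?enum_rankK.
apply: eq_bigr => i _; rewrite /nat_extension; case: insubP => [u _ e|].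
  by congr `|g (enum_val _)|; apply: val_inj.
by rewrite ltn_ord.
Qed.

Lemma nat_extension_Lfun (g : J -> R) :
  nat_extension g \in Lfun (@counting nat R) 1%E.
Proof.
apply/andP; split; apply: mem_set.
  by [].
by rewrite /= /finite_norm Lnorm1_nat_extension ltry.
Qed.

Lemma finite_embedding_L1 (M : Type) (dM : M -> M -> R) (D s : R)
    (f : M -> J -> R) :
  1 <= D -> 0 < s ->
  (forall x y, s * dM x y <= \sum_j `|f x j - f y j| <= D * s * dM x y) ->
  embeds_into_L1 dM D.
Proof.
move=> D1 s0 fP; split=> //.
pose F x := Lfun_Sub (lexx (1%E : \bar R)) (nat_extension_Lfun (f x)).
exists _, nat, (@counting nat R), s, F; split=> // x y.
have -> : 'N[@counting nat R]_1[EFin \o (F x - F y)%R]%E =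
   (\sum_j `|f x j - f y j|)%:E.
  rewrite -Lnorm1_nat_extension; apply: eq_Lnorm => n /=; congr EFin.
  transitivity (nat_extension (f x) n - nat_extension (f y) n); first by [].
  by rewrite /nat_extension; case: insub => //; rewrite subr0.
by rewrite !lee_fin; apply/andP.
Qed.

End FiniteL1.

(** * Cuts of the lamplighter graph *)

Section LampSide.
Variables (G : sgraph) (L : finType).
Implicit Types (f : G -> L) (l : L) (u v : {set G} * G).
Implicit Types (A B : {set G}) (x y : G).

Definition fiber f l : {set G} := [set z | f z == l].

(** While the lamplighter stays on one side of the fibre, the lamps on the other side are frozen;
    these are the lamps recorded. *)
Definition lamp_side f l u : bool * {set G} :=
  (f u.2 == l, if f u.2 == l then u.1 :\: fiber f l else u.1 :&: fiber f l).

Definition lamp_support u v : {set G} := [set u.2; v.2] :|: symdiff u.1 v.1.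

(** If both positions are on the same side, whichever of [z] and [z'] is on the other side is a
    recorded lamp that differs. *)
Lemma lamp_side_neq f l u v z z' :
  z \in lamp_support u v -> z' \in lamp_support u v ->
  f z = l -> f z' != l -> lamp_side f l u != lamp_side f l v.
Proof.
move=> zZ z'Z fz fz'; apply/eqP; case: u v zZ z'Z => [A x] [B y] /=.
rewrite /lamp_side /= !inE /= => zZ z'Z [e]; rewrite -e.
case: eqP => [fx|fx] /finset.setP AB.
  have /eqP fy : f y == l by rewrite -e fx eqxx.
  have := AB z'; move: z'Z; rewrite !inE fz' /=.
  case/orP=> [/orP[]/eqP z'E|].
  - by rewrite z'E fx eqxx in fz'.
  - by rewrite z'E fy eqxx in fz'.
  - by case: (z' \in A); case: (z' \in B).
have /eqP fy : f y != l by rewrite -e; apply/eqP.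
have := AB z; move: zZ; rewrite !inE fz eqxx !andbT /=.
case/orP=> [/orP[]/eqP zE|].
- by rewrite -zE fz in fx.
- by rewrite -zE fz in fy.
- by case: (z \in A); case: (z \in B).
Qed.

Lemma card_imset_lamp_side f u v :
  (#|f @: lamp_support u v|.-1
    <= \sum_l (lamp_side f l u != lamp_side f l v))%N.
Proof.
set Z := lamp_support u v; have [Z1|Z1] := leqP #|f @: Z| 1.
  by case: #|_| Z1 => [|[]].
apply: leq_trans (leq_pred _) _; rewrite -sum1_card [leqLHS]big_mkcond.
apply: leq_sum => l _; case: ifP => // lZ; rewrite lt0b.
have [z zZ fz] := imsetP lZ.
have /set0Pn[l'] : (f @: Z) :\ l != finset.set0.
  by rewrite -card_gt0; move: Z1; rewrite (cardsD1 l) lZ.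
rewrite !inE => /andP[l'l /imsetP[z' z'Z fz']].
by apply: lamp_side_neq zZ z'Z (esym fz) _; rewrite -fz'.
Qed.

Lemma lamp_side_move f A x y :
  (\sum_l (lamp_side f l (A, x) != lamp_side f l (A, y)) <= 2 * (f x != f y))%N.
Proof.
have [fxy|fxy] := eqVneq (f x) (f y).
  by rewrite big1 // => l _; rewrite /lamp_side /= fxy eqxx.
apply: (@leq_trans (\sum_(l in [set f x; f y]) 1)); last first.
  by rewrite sum1_card cards2 fxy.
rewrite [leqRHS]big_mkcond; apply: leq_sum => l _; rewrite !inE /lamp_side /=.
by rewrite ![l == _]eq_sym; case: (f x == l); case: (f y == l); rewrite ?eqxx.
Qed.

Lemma lamp_side_switch f l A B x :
  symdiff A B = [set x] -> lamp_side f l (A, x) = lamp_side f l (B, x).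
Proof.
move=> /finset.setP AB; rewrite /lamp_side /=; congr pair.
by case: eqP => fx; apply/finset.setP => z; have := AB z; rewrite !inE;
  case: (eqVneq z x) => [->|_]; case: (_ \in A); case: (_ \in B);
  rewrite ?andbF//= ?fx ?eqxx //; move/eqP: fx => /negbTE ->.
Qed.

End LampSide.

Lemma sum_indicator_diff (R : realType) (Q : finType) (a b : Q) :
  \sum_q `|(a == q)%:R - (b == q)%:R| = (2 * (a != b))%N%:R :> R.
Proof.
have [->|ab] := eqVneq a b.
  by rewrite big1 // => q _; rewrite subrr normr0.
have ba : (b == a) = false by rewrite eq_sym; apply: negbTE.
rewrite (bigD1 a) //= eqxx ba subr0 normr1 (bigD1 b) ?ba //= eqxx (negbTE ab).
rewrite sub0r normrN1 big1 ?addr0 ?natrD // => q /andP[qa qb].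
by rewrite ![_ == q]eq_sym (negbTE qa) (negbTE qb) subrr normr0.
Qed.

Lemma gdist_lipschitz (R : realType) (G : sgraph) (F : G -> G -> R) (M : R) :
  connected_graph G -> (forall x, F x x = 0) ->
  (forall x y z, F x z <= F x y + F y z) ->
  (forall x y, adj x y -> F x y <= M) ->
  forall x y, F x y <= M * (gdist x y)%:R.
Proof.
move=> cG F0 Ft FM x y; have [p [xp <- <-]] := gdistP cG x y.
elim: p x xp => [|z p IH] x /=; first by rewrite F0 mulr0.
move=> /andP[xz zp]; apply: le_trans (Ft x z _) _.
by rewrite -natr1 mulrDr mulr1 addrC lerD // ?FM ?IH.
Qed.

Section LamplighterEmbedding.
Variables (R : realType) (G : sgraph) (W I L : finType) (c : W -> I -> G -> L).

(** Indicators of the values of [lamp_side] detect movement; the [#|W|] copies of the lamp set pay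
    for switching lamps. *)
Definition lamp_embedding (u : {set G} * G)
    (j : (W * I * L * (bool * {set G})) + (W * G)) : R :=
  match j with
  | inl t => (lamp_side (c t.1.1.1 t.1.1.2) t.1.2 u == t.2)%:R
  | inr t => (t.2 \in u.1)%:R
  end.

Lemma lamp_embedding_dist u v :
  \sum_j `|lamp_embedding u j - lamp_embedding v j| =
  (2 * \sum_w \sum_i \sum_l (lamp_side (c w i) l u != lamp_side (c w i) l v)
   + #|W| * #|symdiff u.1 v.1|)%N%:R.
Proof.
rewrite big_sumType /= natrD; congr (_ + _).
  pose ne w i l : nat := lamp_side (c w i) l u != lamp_side (c w i) l v.
  transitivity (\sum_(t : W * I * L) (2 * ne t.1.1 t.1.2 t.2)%N%:R : R).
    rewrite -(pair_bigA _ (fun (t : W * I * L) q =>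
      `|(lamp_side (c t.1.1 t.1.2) t.2 u == q)%:R -
        (lamp_side (c t.1.1 t.1.2) t.2 v == q)%:R|)) /=.
    by apply: eq_bigr => -[[w i] l] _ /=; rewrite sum_indicator_diff.
  rewrite -natr_sum -big_distrr /=; congr (_ * _)%N%:R.
  rewrite -(pair_bigA _ (fun (t : W * I) l => ne t.1 t.2 l)) /=.
  by rewrite -(pair_bigA _ (fun w i => \sum_l ne w i l)%N).
rewrite -(pair_bigA _ (fun (w : W) x => `|(x \in u.1)%:R - (x \in v.1)%:R|)) /=.
rewrite sumr_const natrM -[LHS]mulr_natl; congr (_ * _).
rewrite -sum1_card natr_sum [RHS]big_mkcond; apply: eq_bigr => x _.
rewrite /symdiff !inE; case: (x \in u.1); case: (x \in v.1) => /=;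
  by rewrite ?subrr ?subr0 ?sub0r ?normrN ?normr1 ?normr0.
Qed.

Lemma lamp_embedding_lower : connected_graph G ->
  (forall w Z, Z != finset.set0 -> tour Z (4 * \sum_i (#|c w i @: Z|).-1)) ->
  forall u v : lamplighter G,
  #|W|%:R / 4 * (gdist u v)%:R
    <= \sum_j `|lamp_embedding u j - lamp_embedding v j|.
Proof.
move=> cG ct [A x] [B y]; rewrite lamp_embedding_dist /=.
set S := (\sum_w _)%N; set d := #|symdiff A B|.
(* The factor 8 is two rounds of a tour of length 4 times the label sum. *)
have le : (#|W| * @gdist (lamplighter G) (A, x) (B, y) <= 8 * S + #|W| * d)%N.
  rewrite -!sum_nat_const big_distrr -big_split /=; apply: leq_sum => w _.
  set Z := lamp_support (A, x) (B, y).
  have xZ : x \in Z by rewrite !inE eqxx.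
  have Z0 : Z != finset.set0 by apply/set0Pn; exists x.
  apply: leq_trans
    (lamplighter_gdist_tour cG (A := A) (B := B) (ct w Z Z0) xZ _ _) _.
  - by rewrite !inE eqxx orbT.
  - exact: finset.subsetUr.
  rewrite leq_add2r mulnA leq_mul2l /=; apply: leq_sum => i _.
  exact: card_imset_lamp_side.
have :
    (#|W| * @gdist (lamplighter G) (A, x) (B, y) <= 4 * (2 * S + #|W| * d))%N.
  by apply: leq_trans le _; clear; lia.
rewrite -(ler_nat R) natrM [(4 * _)%N%:R]natrM => {}le.
by rewrite mulrAC ler_pdivrMr ?ltr0n // [leRHS]mulrC.
Qed.

(** Only edges need checking. The factor 4 combines the two labels affected by a move and the two
    indicators changed for each; a switch changes only the [#|W|] lamp coordinates. *)
Lemma lamp_embedding_upper (D : R) : connected_graph G -> 1 <= D ->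
  (forall x y, adj x y ->
     (\sum_w \sum_i (c w i x != c w i y))%N%:R <= #|W|%:R * D) ->
  forall u v : lamplighter G,
  \sum_j `|lamp_embedding u j - lamp_embedding v j|
    <= #|W|%:R * (4 * D) * (gdist u v)%:R.
Proof.
move=> cG D1 cD; apply: gdist_lipschitz (lamplighter_connected cG) _ _ _.
- by move=> u; rewrite big1 // => j _; rewrite subrr normr0.
- move=> u v w; rewrite -big_split /=; apply: ler_sum => j _.
  exact: ler_distD.
have W0 : 0 <= #|W|%:R :> R by [].
move=> [A x] [B y] /orP[/= /andP[/eqP<- xy]|/= /andP[/eqP<- /eqP AB]];
    rewrite lamp_embedding_dist /=.
  rewrite /symdiff finset.setDv finset.setU0 cards0 muln0 addn0.
  apply: le_trans (_ : (4 * \sum_w \sum_i (c w i x != c w i y))%N%:R <= _).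
    rewrite ler_nat (_ : 4 = 2 * 2)%N // -mulnA leq_mul2l /= big_distrr.
    apply: leq_sum => w _; rewrite big_distrr; apply: leq_sum => i _.
    exact: lamp_side_move.
  by rewrite natrM mulrCA ler_pM2l ?cD.
rewrite AB cards1 muln1 big1 ?muln0 ?add0n; last first.
  move=> w _; rewrite big1 // => i _; rewrite big1 // => l _.
  by rewrite (lamp_side_switch _ _ AB) eqxx.
by rewrite ler_peMr //; lra.
Qed.

End LamplighterEmbedding.

(** * Numerical constants *)

Section Constant.
Variable R : realType.

Lemma half_le_ln (z : R) : 2 <= z -> 1 / 2 <= ln z.
Proof.
move=> z2; apply: (@le_trans _ _ (ln 2)); last by rewrite ler_ln ?posrE //; lra.
have := @le_ln1Dx R (- (1 / 2)); have -> : 1 + - (1 / 2) = 2^-1 :> R by lra.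
by rewrite lnV ?posrE // => /(_ _) => h; have := h ltac:(lra); lra.
Qed.

(** Both inequalities in [1 + 4 * z <= 8 * z <= z ^+ 4] hold from 2 on. *)
Lemma affine_le_expr4 (z : R) : 2 <= z -> 1 + 4 * z <= z ^+ 4.
Proof.
move=> z2; have z0 : 0 <= z by lra.
have z20 : 0 <= z - 2 by lra.
have : 0 <= z * (z - 2) * (z ^+ 2 + 2 * z + 4).
  by rewrite mulr_ge0 ?(mulr_ge0 z0) // !addr_ge0 ?sqr_ge0 ?mulr_ge0.
have -> : z * (z - 2) * (z ^+ 2 + 2 * z + 4) = z ^+ 4 - 8 * z by ring.
lra.
Qed.

(** The left side is at most [3 + ln k <= 3 + 4 * ln m], and [3 <= 6 * ln m] by [half_le_ln]. *)
Lemma harmonic_number_le_ln (k : nat) (chi : int) :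
  (0 < k)%N -> k%:Z <= 1 + 4 * chi ->
  2 + harmonic_number R k <= 10 * ln (Num.max 2 chi)%:~R.
Proof.
move=> k0 kchi; set m := Num.max 2 chi.
have m2 : 2 <= m%:~R :> R by rewrite (ler_int R 2) le_max lexx.
have := harmonic_number_le R k0.
have km : k%:R <= m%:~R ^+ 4 :> R.
  have km : k%:Z <= 1 + 4 * m.
    by apply: le_trans kchi _; rewrite lerD2l ler_pM2l // le_max lexx orbT.
  have : k%:R <= 1 + 4 * m%:~R :> R.
    by move: km; rewrite -(ler_int R) rmorphD rmorphM.
  by move=> h; apply: le_trans h (affine_le_expr4 m2).
have k0' : 0 < k%:R :> R by rewrite ltr0n.
have : ln k%:R <= 4 * ln m%:~R :> R.
  rewrite mulr_natl -lnXn; last by lra.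
  by rewrite ler_ln ?posrE // exprn_gt0 //; lra.
have := half_le_ln m2; lra.
Qed.

End Constant.

Theorem corollary10 (R : realType) :
  exists C : R, forall G : sgraph, connected_graph G ->
    embeds_into_L1 (fun u v : lamplighter G => (gdist u v)%:R : R)
      (C * ln ((Num.max 2 (euler_char G))%:~R : R)).
Proof.
(* The constant is [4 * 4 * 10]: the lower factor [1 / 4], the upper factor [4 * D], and [D] at most
   10 times the logarithm. *)
exists 160 => G cG.
have ln2 : 1 / 2 <= ln (Num.max 2 (euler_char G))%:~R :> R.
  by apply: half_le_ln; rewrite (ler_int R 2) le_max lexx.
(* The empty graph is vacuously connected, and its lamplighter graph has no vertices. *)
have [rho _|G0] := pickP G; last first.
  apply: (@finite_embedding_L1 R unit _ _ _ 1 (fun _ _ => 0)); [lra|by []|].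
  by move=> u; have := G0 u.2.
have [W [I [L [c [k [W0 k0 kchi ct cD]]]]]] := random_labels R rho cG.
have H0 := harmonic_number_ge0 R k; have H := harmonic_number_le_ln R k0 kchi.
have W0' : 0 < #|W|%:R :> R by rewrite ltr0n.
apply: (@finite_embedding_L1 R _ _ _ _ (#|W|%:R / 4)
  (@lamp_embedding R G W I L c)).
- lra.
- by rewrite divr_gt0.
move=> u v; apply/andP; split; first exact: lamp_embedding_lower.
apply: le_trans (lamp_embedding_upper cG _ cD u v) _; first by lra.
rewrite ler_wpM2r //; set l := ln _.
rewrite [leRHS](_ : _ = #|W|%:R * (40 * l)); last by field.
by rewrite ler_wpM2l // /l; lra.
Qed.
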